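(* Let $R$ be an integral domain, let $\ast=\tilde{\ast}$ be a star operation on $R$ that is spectral and of finite type, and assume that each $\ast$-prime ideal of $R$ is contained in a unique $\ast$-maximal ideal (e.g., $R$ has $\ast$-dimension one). Then the following conditions are equivalent: (i) $R$ has the $\ast$-finite character; (ii) $R$ has the $\ast$-local $\ast$-invertibility property.
   Context: $R$ is an integral domain with field of fractions $K$. An ideal of $R$ means a nonzero fractional ideal (an integral ideal if contained in $R$); prime ideals are integral and nonzero. $\mathcal F(R)$ is the set of ideals, and $(J:I)=\{x\in K: xI\subseteq J\}$. A star operation on $R$ is a map $\mathcal F(R)\to\mathcal F(R)$, $I\mapsto I^\ast$, such that for all $0\ne a\in K$ and $I,J\in\mathcal F(R)$: $R^\ast=R$ and $(aI)^\ast=aI^\ast$; $I\subseteq I^\ast$, and $I\subseteq J$ implies $I^\ast\subseteq J^\ast$; $I^{\ast\ast}=I^\ast$. It is of finite type if $I^\ast=\bigcup\{J^\ast: J\subseteq I,\ J \text{ a finitely generated ideal}\}$ for all $I$. $I$ is a $\ast$-ideal if $I=I^\ast$; a $\ast$-prime is a prime ideal that is a $\ast$-ideal; a $\ast$-maximal ideal is a maximal element of the set of proper integral $\ast$-ideals; $\ast\text{-Max}(R)$ is the set of $\ast$-maximal ideals. For $\ast$ of finite type, $\tilde{\ast}$ is the star operation $I\mapsto\bigcap_{M\in\ast\text{-Max}(R)}IR_M$; one has $\ast=\tilde\ast$ exactly when $\ast$ is spectral (i.e. $I^\ast=\bigcap_{P\in\mathcal G}IR_P$ for some family $\mathcal G$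 of pairwise incomparable primes with $R=\bigcap_{P\in\mathcal G}R_P$) and of finite type. $R$ has the $\ast$-finite character if each nonzero element of $R$ is contained in at most finitely many $\ast$-maximal ideals. $R$ has the $\ast$-local $\ast$-invertibility property if each ideal $I$ such that $I^\ast R_M$ is principal for all $M\in\ast\text{-Max}(R)$ is $\ast$-invertible, i.e. $(I(R:I))^\ast=R$. $R$ has $\ast$-dimension one if each $\ast$-prime ideal has height one. *)

(* Defs.v *)
From HB Require Import structures.
From mathcomp Require Import all_boot all_order all_algebra fraction.
From mathcomp Require Import mathcomp_extra boolp classical_sets functions.
From mathcomp Require Import cardinality.

Set Implicit Arguments.
Unset Strict Implicit.
Unset Printing Implicit Defensive.

Import GRing.Theory.
Local Open Scope classical_set_scope.
Local Open Scope ring_scope.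

Notation "x %:F" := (tofrac x) : ring_scope.

(* Throughout, K := {fraction R} is the field of fractions of R, and subsets
   of K are classical sets; R itself is identified with its image in K. *)

Definition ring_set (R : idomainType) : set {fraction R} :=
  range (fun a : R => a%:F).
Arguments ring_set R : clear implicits.

(* "Ideal" means nonzero fractional ideal. *)
Record ideal (R : idomainType) (I : set {fraction R}) : Prop := {
  ideal_nonzero : exists2 x, I x & x != 0;
  ideal_add : forall x y, I x -> I y -> I (x + y);
  ideal_smul : forall (a : R) x, I x -> I (a%:F * x);
  ideal_denominator :
    exists2 d : R, d != 0 & forall x, I x -> ring_set R (d%:F * x)
}.

Definition integral (R : idomainType) (I : set {fraction R}) : Prop :=
  I `<=` ring_set R.

Record prime_ideal (R : idomainType) (P : set {fraction R}) : Prop := {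
  prime_ideal_ideal : ideal P;
  prime_ideal_integral : integral P;
  prime_ideal_proper : P <> ring_set R;
  prime_ideal_mul : forall a b : R, P (a * b)%:F -> P a%:F \/ P b%:F
}.

Definition finitely_generated (R : idomainType) (J : set {fraction R}) : Prop :=
  exists n (g : 'I_n -> {fraction R}),
    J = [set x | exists c : 'I_n -> R, x = \sum_(i < n) (c i)%:F * g i].

Definition scale_set (R : idomainType) (x : {fraction R})
    (I : set {fraction R}) : set {fraction R} :=
  [set x * y | y in I].

(* All finite sums of products: this is both the product of two ideals and,
   with [J := localization P], the extension of [I] to the localization. *)
Definition mul_set (R : idomainType) (I J : set {fraction R}) :
    set {fraction R} :=
  [set x | exists n (u v : 'I_n -> {fraction R}),
     (forall i, I (u i) /\ J (v i)) /\ x = \sum_(i < n) u i * v i].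

Definition colon (R : idomainType) (J I : set {fraction R}) :
    set {fraction R} :=
  [set x | scale_set x I `<=` J].

Definition localization (R : idomainType) (P : set {fraction R}) :
    set {fraction R} :=
  [set x | exists a s : R, ~ P s%:F /\ x = a%:F / s%:F].

(* A map on the set of ideals is represented by a map on all subsets of K whose
   values outside the ideals are irrelevant. *)
Record star_operation (R : idomainType)
    (star : set {fraction R} -> set {fraction R}) : Prop := {
  star_ideal_closed : forall I, ideal I -> ideal (star I);
  star_ring : star (ring_set R) = ring_set R;
  star_scale : forall a I, a != 0 -> ideal I ->
    star (scale_set a I) = scale_set a (star I);
  star_extensive : forall I, ideal I -> I `<=` star I;
  star_monotone : forall I J, ideal I -> ideal J ->
    I `<=` J -> star I `<=` star J;
  star_idempotent : forall I, ideal I -> star (star I) = star I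
}.

Section StarNotions.
Variables (R : idomainType) (star : set {fraction R} -> set {fraction R}).

Definition finite_type : Prop :=
  forall I, ideal I ->
    star I = \bigcup_(J in [set J | [/\ ideal J, finitely_generated J &
                                        J `<=` I]]) star J.

Definition star_ideal (I : set {fraction R}) : Prop := ideal I /\ I = star I.

Definition star_prime (P : set {fraction R}) : Prop :=
  prime_ideal P /\ star_ideal P.

Definition proper_integral_star_ideal (I : set {fraction R}) : Prop :=
  [/\ star_ideal I, integral I & I <> ring_set R].

Definition star_Max : set (set {fraction R}) :=
  [set M | proper_integral_star_ideal M /\
           forall J, proper_integral_star_ideal J -> M `<=` J -> J = M].

Definition star_tilde (I : set {fraction R}) : set {fraction R} :=
  \bigcap_(M in star_Max) mul_set I (localization M).

Definition spectral : Prop :=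
  exists G : set (set {fraction R}),
    [/\ forall P, G P -> prime_ideal P,
        forall P Q, G P -> G Q -> P `<=` Q -> P = Q,
        ring_set R = \bigcap_(P in G) localization P &
        forall I, ideal I -> star I = \bigcap_(P in G) mul_set I (localization P)].

Definition star_finite_character : Prop :=
  forall x : R, x != 0 -> finite_set [set M | star_Max M /\ M x%:F].

Definition locally_principal_at (M I : set {fraction R}) : Prop :=
  exists x : {fraction R},
    mul_set (star I) (localization M) = scale_set x (localization M).

Definition star_invertible (I : set {fraction R}) : Prop :=
  star (mul_set I (colon (ring_set R) I)) = ring_set R.

Definition star_local_star_invertibility : Prop :=
  forall I, ideal I -> (forall M, star_Max M -> locally_principal_at M I) ->
    star_invertible I.

End StarNotions.

(* Main.v *)
Require Import Defs.
From mathcomp Require Import all_boot all_order all_algebra fraction ring.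
From mathcomp Require Import boolp classical_sets cardinality.

(** For [x <> 0] let [Y] be the set of star-maximal ideals containing [x].

    (i) => (ii): let [I] be locally principal, [w] a nonzero element of [I] and
    [d] a denominator of [I], with [x = d w].  If [x] is not in [M], then
    [w d] witnesses that [I (R : I)] is not contained in [M].  If [M] is in [Y],
    let [z_N] in [I] generate [I] at [N], for [N] in the finite set [Y].  Some
    [u] outside [M] multiplies [w] and all the [z_N] into [z_M R]; checking
    locally, [u / z_M] lies in [(R : I)], and [(u / z_M) z_M = u].

    (ii) => (i): two distinct star-maximal ideals share no nonzero prime, so for
    [M <> N] there are [s] outside [M] and [t] outside [N] with [s t] in [x R].
    Hence [x R_M] contracted to [R] is principal at [M] and trivial elsewhere.
    It is therefore star-invertible, and this yields an element outside [M]
    which lies in every other member of [Y].  The elements of [R] that lie in all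
    but finitely many members of [Y] thus form an ideal contained in no
    star-maximal ideal; as star has finite type, finitely many such elements
    already avoid every star-maximal ideal, and [Y] is finite. *)

Set Implicit Arguments.
Unset Strict Implicit.
Unset Printing Implicit Defensive.

Import GRing.Theory.
Local Open Scope classical_set_scope.
Local Open Scope ring_scope.

(** * Cancellation identities in a field *)

Lemma mulf_clear_denom (F : fieldType) (s x a : F) :
  s != 0 -> s * (x * (a / s)) = a * x.
Proof. by move=> s0; rewrite mulrCA [s * _]mulrC divfK// mulrC. Qed.

Lemma mulf_divK (F : fieldType) (z c u y : F) :
  z != 0 -> c * (u / z * y) * z = c * (u * y).
Proof. by move=> z0; rewrite -mulrA mulrAC divfK. Qed.

(** * Fractional ideals and the construction of primes *)

Section Ideals.
Variable R : idomainType.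
Implicit Types (I P : set {fraction R}) (x y z : {fraction R}) (a r s t : R).

Lemma mem_ring_set a : ring_set R a%:F.
Proof. by exists a. Qed.

Lemma ring_setD x y : ring_set R x -> ring_set R y -> ring_set R (x + y).
Proof. by move=> [a _ <-] [b _ <-]; exists (a + b); rewrite ?rmorphD. Qed.

Lemma ring_setM x y : ring_set R x -> ring_set R y -> ring_set R (x * y).
Proof. by move=> [a _ <-] [b _ <-]; exists (a * b); rewrite ?rmorphM. Qed.

Lemma ideal0 I : ideal I -> I 0.
Proof.
move=> hI; have [x Ix _] := ideal_nonzero hI.
by have := ideal_smul hI 0 Ix; rewrite rmorph0 mul0r.
Qed.

Lemma ideal_sum I n (f : 'I_n -> {fraction R}) :
  ideal I -> (forall i, I (f i)) -> I (\sum_(i < n) f i).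
Proof.
move=> hI If; apply: (big_ind I) => //; first exact: ideal0.
exact: (ideal_add hI).
Qed.

Lemma integral_idealI I :
    (exists2 x, I x & x != 0) -> (forall x y, I x -> I y -> I (x + y)) ->
    (forall a x, I x -> I (a%:F * x)) -> integral I ->
  ideal I.
Proof.
move=> I0 ID IZ IR; split=> //.
by exists 1; rewrite ?oner_neq0// => x Ix; rewrite rmorph1 mul1r; apply: IR.
Qed.

Lemma ideal_ring_set : ideal (ring_set R).
Proof.
apply: integral_idealI => //; last 1 first.
- by move=> a x; apply: ring_setM; apply: mem_ring_set.
- by exists 1%:F; [exact: mem_ring_set | rewrite rmorph1 oner_neq0].
- exact: ring_setD.
Qed.

Lemma integral_ideal1 I : ideal I -> integral I -> I 1 -> I = ring_set R.
Proof.
move=> hI IR I1; apply/seteqP; split=> // _ [a _ <-].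
by rewrite -[_%:F]mulr1; apply: (ideal_smul hI).
Qed.

(** The ideal [I + aR], used in both primality proofs to enlarge a maximal ideal. *)
Definition adjoin I a : set {fraction R} :=
  [set z | exists y r, I y /\ z = y + (r * a)%:F].

Lemma sub_adjoin I a : I `<=` adjoin I a.
Proof. by move=> y Iy; exists y, 0; rewrite mul0r rmorph0 addr0. Qed.

Lemma mem_adjoin I a : ideal I -> adjoin I a a%:F.
Proof. by move=> hI; exists 0, 1; rewrite mul1r add0r; split; first exact: ideal0. Qed.

Lemma adjoin_integral I a : integral I -> integral (adjoin I a).
Proof.
move=> IR _ [y [r [Iy ->]]].
by apply: ring_setD; [exact: IR | exact: mem_ring_set].
Qed.

Lemma adjoin_ideal I a : ideal I -> integral I -> ideal (adjoin I a).
Proof.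
move=> hI IR; apply: integral_idealI; last exact: adjoin_integral.
- by have [x Ix x0] := ideal_nonzero hI; exists x => //; apply: sub_adjoin.
- move=> _ _ [y [r [Iy ->]]] [z [s [Iz ->]]].
  exists (y + z), (r + s); split; first exact: (ideal_add hI).
  by rewrite mulrDl rmorphD /= addrACA.
- move=> c _ [y [r [Iy ->]]]; exists (c%:F * y), (c * r).
  by split; [exact: (ideal_smul hI) | rewrite mulrDr -mulrA [in RHS]rmorphM].
Qed.

(** Zorn's lemma gives an integral ideal maximal among those that contain [x] and miss [S];
    multiplicativity of [S] makes it prime. *)
Lemma exists_prime_disjoint (S : set R) (x : R) :
    x != 0 -> S 1 -> (forall s t, S s -> S t -> S (s * t)) ->
    (forall r, ~ S (r * x)) ->
  exists P, [/\ prime_ideal P, P x%:F & forall s, S s -> ~ P s%:F].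
Proof.
move=> x0 S1 SM Sx.
pose good P := [/\ ideal P, integral P, P x%:F & forall s, S s -> ~ P s%:F].
have goodx : good (range (fun r => (r * x)%:F)).
  have xx : range (fun r => (r * x)%:F) x%:F by exists 1; rewrite ?mul1r.
  have xR : integral (range (fun r => (r * x)%:F)).
    by move=> _ [r _ <-]; apply: mem_ring_set.
  split=> //.
  - apply: integral_idealI => //.
    + by exists x%:F => //; rewrite tofrac_eq0.
    + by move=> _ _ [r _ <-] [s _ <-]; exists (r + s); rewrite // mulrDl rmorphD.
    + by move=> c _ [r _ <-]; exists (c * r); rewrite // -mulrA [LHS]rmorphM.
  - by move=> s Ss [r _ /eqP]; rewrite tofrac_eq => /eqP rs; apply: (Sx r); rewrite rs.
(* [set0] is added because [Zorn_bigcup] also requires the union of the empty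
   chain to be admissible *)
have [|P [PP Pmax]] := @Zorn_bigcup _ [set P | P = set0 \/ good P].
  move=> F FP Ftot /=.
  have [[A FA A0]|noA] := pselect (exists2 A, F A & A <> set0); last first.
    left; apply/seteqP; split=> // y [B FB By].
    by case: noA; exists B => // B0; rewrite B0 in By.
  have goodF B y : F B -> B y -> good B.
    by move=> FB By; have [B0|//] := FP _ FB; rewrite B0 in By.
  have gA : good A by have [|//] := FP _ FA.
  have UR : integral (\bigcup_(X in F) X).
    by move=> y [B FB By]; have [_ BR _ _] := goodF _ _ FB By; apply: BR.
  right; split=> //.
  - apply: integral_idealI => //.
    + have [[[y Ay y0] _ _ _] _ _ _] := gA; exists y => //; exact: (bigcup_sup FA).
    + move=> y z [B FB By] [C FC Cz].
      have [[_ BD _ _] _ _ _] := goodF _ _ FB By.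
      have [[_ CD _ _] _ _ _] := goodF _ _ FC Cz.
      have [BC|CB] := Ftot _ _ FB FC.
        by exists C => //; apply: CD => //; apply: BC.
      by exists B => //; apply: BD => //; apply: CB.
    + move=> a y [B FB By]; exists B => //.
      by have [[_ _ BZ _] _ _ _] := goodF _ _ FB By; apply: BZ.
  - by exists A => //; have [] := gA.
  - by move=> s Ss [B FB Bs]; have [_ _ _ /(_ s Ss)] := goodF _ _ FB Bs.
have gP : good P.
  (* The empty set is not maximal: [xR] is admissible and strictly larger. *)
  have [P0|//] := PP; exfalso; apply: (Pmax (range (fun r => (r * x)%:F))); last by right.
  rewrite P0; split=> // /(_ x%:F); apply.
  by exists 1; rewrite ?mul1r.
have [hP PR Px PS] := gP.
have meet a : ~ P a%:F -> exists2 s, S s & adjoin P a s%:F.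
  move=> Pa; apply: contrapT => noS; apply: (Pmax (adjoin P a)).
    split; last by move=> /(_ a%:F (mem_adjoin a hP)).
    exact: sub_adjoin.
  right; split; [exact: adjoin_ideal|exact: adjoin_integral|exact: sub_adjoin|].
  by move=> s Ss As; apply: noS; exists s.
exists P; split=> //; split=> //.
  by move=> PE; apply: (PS 1 S1); rewrite PE; apply: mem_ring_set.
move=> a b Pab; apply: contrapT => /not_orP[/meet[s Ss [y [r [Py sE]]]]].
move=> /meet[t St [z [q [Pz tE]]]].
apply: (PS (s * t)); first exact: SM.
(* Here [s = y + r a] and [t = z + q b]; each term lies in [P] because [y], [z] and [a b] do. *)
have -> : (s * t)%:F = t%:F * y + ((r * a)%:F * z + (r * q)%:F * (a * b)%:F).
  by rewrite tofracM sE tE !tofracM; ring.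
by apply: (ideal_add hP); [|apply: (ideal_add hP)]; apply: (ideal_smul hP).
Qed.

(** * Localization at a prime *)

Section Prime.
Variable P : set {fraction R}.
Hypothesis hP : prime_ideal P.

Lemma prime_notin1 : ~ P 1%:F.
Proof.
rewrite rmorph1 => P1; apply: (prime_ideal_proper hP).
exact: (integral_ideal1 (prime_ideal_ideal hP) (prime_ideal_integral hP) P1).
Qed.

Lemma prime_notinM s t : ~ P s%:F -> ~ P t%:F -> ~ P (s * t)%:F.
Proof. by move=> Ps Pt /(prime_ideal_mul hP)[]. Qed.

Lemma prime_notin_neq0 s : ~ P s%:F -> s%:F != 0 :> {fraction R}.
Proof.
move=> Ps; apply/eqP => s0; apply: Ps; rewrite s0.
exact: ideal0 (prime_ideal_ideal hP).
Qed.

(** Clears finitely many denominators at once: the product of the individual witnesses stays outside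
    [P] and satisfies every condition. *)
Lemma prime_common_multiple (T : eqType) (l : seq T) (Q : T -> R -> Prop) :
    (forall i s t, Q i s -> Q i (t * s)) ->
    (forall i, i \in l -> exists2 s, ~ P s%:F & Q i s) ->
  exists2 s, ~ P s%:F & forall i, i \in l -> Q i s.
Proof.
move=> QM; elim: l => [_|i l IHl hl]; first by exists 1 => //; apply: prime_notin1.
have [j jl|s Ps Qs] := IHl; first by apply: hl; rewrite in_cons jl orbT.
have [t Pt Qt] := hl i (mem_head i l).
exists (s * t) => [|j]; first exact: prime_notinM.
rewrite in_cons => /orP[/eqP->|/Qs]; first exact: QM.
by rewrite mulrC; apply: QM.
Qed.

Lemma localization_sub y : localization P y ->
  exists2 s, ~ P s%:F & ring_set R (s%:F * y).
Proof.
move=> [a [s [Ps ->]]]; exists s => //.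
by rewrite mulrC divfK ?prime_notin_neq0//; apply: mem_ring_set.
Qed.

Lemma localization1 : localization P 1.
Proof. by exists 1, 1; split; [exact: prime_notin1|rewrite rmorph1 divr1]. Qed.

(** A finite sum of products has a common denominator outside [P], so a single fraction describes
    the extension of [I]. *)
Lemma mul_set_localizationP I y : ideal I ->
  mul_set I (localization P) y <-> exists2 s, ~ P s%:F & I (s%:F * y).
Proof.
move=> hI; split; last first.
  move=> [s Ps Isy]; exists 1%N, (fun=> s%:F * y), (fun=> 1%:F / s%:F).
  split; first by move=> _; split=> //; exists 1, s.
  by rewrite big_ord1 rmorph1 mul1r mulrC mulKf ?prime_notin_neq0.
move=> [n [u [v [uv ->]]]].
have [i s t Is|i _|s Ps Is] := @prime_common_multiple _ (enum 'I_n)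
    (fun i s => I (s%:F * (u i * v i))).
- by rewrite rmorphM -mulrA; apply: (ideal_smul hI).
- have [Iu /localization_sub[s Ps [a _ sv]]] := uv i.
  by exists s; rewrite // mulrCA -sv mulrC; apply: (ideal_smul hI).
- exists s => //; rewrite mulr_sumr; apply: (ideal_sum hI) => i.
  by apply: Is; rewrite mem_enum.
Qed.

End Prime.

(** * The product of an ideal with its inverse *)

Lemma colonP (J I : set {fraction R}) b :
  colon J I b <-> forall y, I y -> J (b * y).
Proof.
split=> [JIb y Iy|JIb _ [y Iy <-]]; last exact: JIb.
by apply: JIb; exists y.
Qed.

(** It is nonzero because a denominator of [I] lies in [(R : I)]. *)
Lemma mul_colon_ideal I : ideal I -> ideal (mul_set I (colon (ring_set R) I)).
Proof.
move=> hI; apply: integral_idealI.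
- have [y Iy y0] := ideal_nonzero hI; have [d d0 dI] := ideal_denominator hI.
  exists (y * d%:F); last by rewrite mulf_neq0 ?tofrac_eq0.
  exists 1%N, (fun=> y), (fun=> d%:F); rewrite big_ord1; split=> // _.
  by split=> //; apply/colonP.
- move=> _ _ [m [u [v [uv ->]]]] [n [u' [v' [uv' ->]]]].
  (* The sum of two such elements is written by concatenating the two families. *)
  exists (m + n)%N, (fun i => match split i with inl j => u j | inr j => u' j end),
    (fun i => match split i with inl j => v j | inr j => v' j end).
  split; first by move=> i; case: (split i).
  rewrite big_split_ord; congr (_ + _); apply: eq_bigr => i _.
    by rewrite (unsplitK (inl i)).
  by rewrite (unsplitK (inr i)).
- move=> a _ [n [u [v [uv ->]]]]; exists n, (fun i => a%:F * u i), v.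
  split; last by rewrite mulr_sumr; apply: eq_bigr => i _; rewrite mulrA.
  by move=> i; have [Iu Iv] := uv i; split=> //; apply: (ideal_smul hI).
- move=> _ [n [u [v [uv ->]]]]; apply: (ideal_sum ideal_ring_set) => i.
  by have [Iu /colonP Iv] := uv i; rewrite mulrC; apply: Iv.
Qed.

End Ideals.

(** * Star-maximal ideals and local criteria *)

Section Star.
Variables (R : idomainType) (star : set {fraction R} -> set {fraction R}).
Hypothesis hstar : star_operation star.
Implicit Types (I M N : set {fraction R}).

Lemma star_integral I : ideal I -> integral I -> integral (star I).
Proof.
move=> hI IR; rewrite /integral -(star_ring hstar).
exact: (star_monotone hstar hI (ideal_ring_set R) IR).
Qed.

(** If [a] is outside [M], maximality forces the star closure of [M + aR] to be [R]. When [a b] is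
    in [M], applying [star] to [b (M + aR)], a subset of [M], puts [b] in [M]. *)
Lemma star_Max_prime M : star_Max star M -> prime_ideal M.
Proof.
move=> [[[hM ME] MR Mproper] Mmax]; split=> // a b Mab.
apply: contrapT => /not_orP[Ma Mb].
have hA := adjoin_ideal a hM MR; have AR := @adjoin_integral _ _ a MR.
have starA : star (adjoin M a) = ring_set R.
  apply: contrapT => nR; apply: Ma.
  rewrite -(Mmax (star (adjoin M a))).
  - exact/(star_extensive hstar hA)/mem_adjoin.
  - split=> //; last exact: star_integral.
    by split; [exact: (star_ideal_closed hstar) | rewrite (star_idempotent hstar)].
  - by move=> y My; apply: (star_extensive hstar hA); apply: sub_adjoin.
have b0 : b%:F != 0 :> {fraction R}.
  by apply/eqP => b0; apply: Mb; rewrite b0; apply: ideal0.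
have bA : scale_set b%:F (adjoin M a) `<=` M.
  move=> _ [_ [y [r [My ->]]] <-]; rewrite mulrDr.
  apply: (ideal_add hM); first exact: (ideal_smul hM).
  rewrite -tofracM.
  have -> : b * (r * a) = r * (a * b) by ring.
  by rewrite tofracM; apply: (ideal_smul hM).
have hbA : ideal (scale_set b%:F (adjoin M a)).
  apply: integral_idealI.
  - have [y Ay y0] := ideal_nonzero hA.
    by exists (b%:F * y); [exists y | rewrite mulf_neq0].
  - move=> _ _ [y Ay <-] [z Az <-]; exists (y + z); last by rewrite mulrDr.
    exact: (ideal_add hA).
  - move=> c _ [y Ay <-]; exists (c%:F * y); last by rewrite mulrCA.
    exact: (ideal_smul hA).
  - by move=> y /bA; apply: MR.
have := star_monotone hstar hbA hM bA; rewrite -ME (star_scale hstar b0 hA) starA.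
move=> /(_ b%:F) bM; apply/Mb/bM; exists 1; rewrite ?mulr1//.
by exists 1; rewrite ?rmorph1.
Qed.

Hypothesis htilde : forall I, ideal I -> star I = star_tilde star I.

(** The working form of [star = star_tilde]: membership is tested at each star-maximal ideal by
    clearing one denominator. *)
Lemma starP I y : ideal I ->
  star I y <-> forall M, star_Max star M -> exists2 s : R, ~ M s%:F & I (s%:F * y).
Proof.
move=> hI; rewrite htilde//; split=> [Iy M maxM|Iy M maxM].
  by apply/(mul_set_localizationP (star_Max_prime maxM)) => //; apply: Iy.
by apply/(mul_set_localizationP (star_Max_prime maxM)) => //; apply: Iy.
Qed.

Lemma ring_set_local y :
    (forall M, star_Max star M -> exists2 s : R, ~ M s%:F & ring_set R (s%:F * y)) ->
  ring_set R y.
Proof. by rewrite -(starP _ (ideal_ring_set R)) (star_ring hstar). Qed.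

(** If [y] is in [star P], some [s] outside [M], hence outside [P], has [s y] in [P], so [y] is in
    [P]. This lets the uniqueness hypothesis apply to any prime inside [M]. *)
Lemma sub_star_Max_star_prime M P :
  star_Max star M -> prime_ideal P -> P `<=` M -> star_prime star P.
Proof.
move=> maxM hP PM; have hPi := prime_ideal_ideal hP; split=> //; split=> //.
apply/seteqP; split=> [|y sPy]; first exact: (star_extensive hstar).
have [a _ ay] := star_integral hPi (prime_ideal_integral hP) sPy.
have [s Ms] := (starP _ hPi).1 sPy _ maxM.
by rewrite -ay -rmorphM => /(prime_ideal_mul hP)[/PM//|].
Qed.

(** A local generator of [star I] can be moved into [I] itself by multiplying it by elements outside
    [M], which are units at [M]. *)
Lemma locally_principal_atP M I : star_Max star M -> ideal I ->
  locally_principal_at star M I <->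
  exists z, [/\ I z, z != 0 & forall y, I y ->
    exists2 s : R, ~ M s%:F & exists r : R, s%:F * y = r%:F * z].
Proof.
move=> maxM hI; have hM := star_Max_prime maxM.
have hsI := star_ideal_closed hstar hI.
have memP y := mul_set_localizationP hM y hsI.
have IsubM y : I y -> mul_set (star I) (localization M) y.
  move=> Iy; apply/memP; exists 1; first exact: prime_notin1.
  by rewrite rmorph1 mul1r; apply: (star_extensive hstar).
split=> [[x xE]|[z [Iz z0 zI]]].
  rewrite xE in IsubM.
  have /memP[s Ms /(starP _ hI) /(_ _ maxM)[t Mt Itsx]] :
      mul_set (star I) (localization M) x.
    by rewrite xE; exists 1; [exact: localization1 | rewrite mulr1].
  have x0 : x != 0.
    have [y /IsubM[z _ <-]] := ideal_nonzero hI.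
    by apply: contra_neq => ->; rewrite mul0r.
  (* The factor [s] brings [x] into [star I], and [t] then brings it into [I]. *)
  exists (t%:F * (s%:F * x)); split=> //.
    by rewrite !mulf_neq0 ?(prime_notin_neq0 hM).
  move=> y /IsubM[_ [a [q [Mq ->]]] <-].
  exists (q * (t * s)); first by do 2?apply: prime_notinM.
  exists a; rewrite [q * _]mulrC tofracM -mulrA.
  by rewrite mulf_clear_denom ?(prime_notin_neq0 hM)// tofracM -mulrA !(mulrCA a%:F).
exists z; apply/seteqP; split=> [y|_ [_ [a [t [Mt ->]]] <-]].
  move=> /memP[s Ms /(starP _ hI) /(_ _ maxM)[t Mt /zI[q Mq [r E]]]].
  have Mqts : ~ M (q * (t * s))%:F by do 2?apply: prime_notinM.
  exists (r%:F / (q * (t * s))%:F); first by exists r, (q * (t * s)).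
  apply: (mulfI (prime_notin_neq0 hM Mqts)).
  rewrite mulrCA [X in z * X]mulrC divfK ?(prime_notin_neq0 hM)//.
  by rewrite mulrC -E !rmorphM /= !mulrA.
apply/memP; exists t => //.
rewrite mulf_clear_denom ?(prime_notin_neq0 hM)//.
by apply: (star_extensive hstar) => //; apply: (ideal_smul hI).
Qed.

(** Invertibility means that [I (R : I)] lies in no star-maximal ideal. A sum outside [M] has a
    summand outside [M], so one product suffices. *)
Lemma star_invertibleP I : ideal I ->
  star_invertible star I <->
  forall M, star_Max star M ->
    exists a b, [/\ I a, colon (ring_set R) I b & ~ M (a * b)].
Proof.
move=> hI; have hII := mul_colon_ideal hI; split=> [invI M maxM|inv].
  have hM := star_Max_prime maxM.
  have : star (mul_set I (colon (ring_set R) I)) 1.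
    by rewrite invI -(rmorph1 (@tofrac R)); apply: mem_ring_set.
  move=> /(starP _ hII)/(_ _ maxM)[s Ms [n [u [v [uv]]]]]; rewrite mulr1 => sE.
  apply: contrapT => noab; apply: Ms; rewrite sE.
  apply: (ideal_sum (prime_ideal_ideal hM)) => i; apply: contrapT => Muv.
  by apply: noab; exists (u i), (v i); have [] := uv i.
have IIR : integral (mul_set I (colon (ring_set R) I)).
  move=> _ [n [u [v [uv ->]]]]; apply: (ideal_sum (ideal_ring_set R)) => i.
  by have [Iu /colonP Iv] := uv i; rewrite mulrC; apply: Iv.
apply: integral_ideal1; [exact: (star_ideal_closed hstar)|exact: star_integral|].
apply/(starP _ hII) => M /inv[a [b [Ia /[dup] Ib /colonP/(_ _ Ia)[s _ sE] Mab]]].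
exists s; first by rewrite sE mulrC.
rewrite mulr1 sE; exists 1%N, (fun=> a), (fun=> b); rewrite big_ord1 mulrC.
by split.
Qed.

(** * Finite character implies local invertibility *)

Lemma finite_character_local_invertibility :
  star_finite_character star -> star_local_star_invertibility star.
Proof.
move=> fin I hI lpI; apply/star_invertibleP => // M maxM.
have hM := star_Max_prime maxM.
have [w Iw w0] := ideal_nonzero hI; have [d d0 dI] := ideal_denominator hI.
have dF0 : d%:F != 0 :> {fraction R} by rewrite tofrac_eq0.
have [x _ xE] := dI w Iw.
have [Mx|Mx] := pselect (M x%:F); last first.
  by exists w, d%:F; split=> //; [exact/colonP | rewrite mulrC -xE].
have x0 : x != 0 by rewrite -tofrac_eq0 xE mulf_neq0.
have /finite_seqP[Y YE] := fin x x0.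
(* [choice] needs a total function, so [z N] is left unconstrained when [N] is not star-maximal. *)
have gen N : exists z, star_Max star N ->
    [/\ I z, z != 0 & forall y, I y ->
      exists2 s : R, ~ N s%:F & exists r : R, s%:F * y = r%:F * z].
  have [maxN|] := pselect (star_Max star N); last by exists 0.
  by have /(locally_principal_atP maxN hI)[z zP] := lpI N maxN; exists z.
have {gen} [z zP] := choice gen.
have [Iz z0 zI] := zP _ maxM.
have Ymax N : N \in Y -> star_Max star N.
  by move=> NY; have : [set` Y] N by []; rewrite -YE => -[].
have QM (v : {fraction R}) (s t : R) :
    (exists r : R, s%:F * v = r%:F * z M) ->
    exists r : R, (t * s)%:F * v = r%:F * z M.
  by move=> [r rE]; exists (t * r); rewrite !rmorphM -!mulrA /= rE.
(* Including [w] in the list serves the star-maximal ideals outside [Y]. *)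
have [i s t|i|u Mu uY] := @prime_common_multiple _ _ hM _ (w :: map z Y)
    (fun v s => exists r : R, s%:F * v = r%:F * z M); first exact: QM.
  rewrite in_cons => /orP[/eqP->|/mapP[N NY ->]]; first exact: zI.
  by apply: zI; have [] := zP N (Ymax N NY).
exists (z M), (u%:F / z M); split=> //; last by rewrite mulrC divfK.
apply/colonP => y Iy; apply: ring_set_local => N maxN.
have [Nx|Nx] := pselect (N x%:F); last first.
  have [r rE] := uY w (mem_head _ _); have [c _ cE] := dI y Iy.
  (* Since [x = d w], multiplying [(u / z M) y] by [x] gives [d y] times [u w / z M], both in
     [R]. *)
  exists x => //; exists (c * r) => //; rewrite rmorphM /= cE xE.
  apply: (mulIf z0).
  by rewrite mulf_divK// [u%:F * y]mulrC mulrACA [w * _]mulrC rE !mulrA.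
have NY : N \in Y by have : [set` Y] N by rewrite -YE.
have [|r rE] := uY (z N); first by rewrite in_cons map_f ?orbT.
have [_ _ /(_ y Iy)[s Ns [q qE]]] := zP N maxN.
(* Here [s y = q z N] and [u z N = r z M]. *)
exists s => //; exists (q * r) => //; rewrite rmorphM /=.
apply: (mulIf z0).
by rewrite mulf_divK// mulrCA qE mulrCA rE mulrA.
Qed.

(** * Local invertibility implies finite character *)

Hypothesis hunique : forall P, star_prime star P ->
  exists! M, star_Max star M /\ P `<=` M.

(** Otherwise the products [s t] form a multiplicative set missing [xR]. A prime that contains [x]
    and misses this set lies in both [M] and [N], against uniqueness. *)
Lemma star_Max_separation M N (x : R) :
    star_Max star M -> star_Max star N -> M <> N -> x != 0 ->
  exists s t r : R, [/\ ~ M s%:F, ~ N t%:F & s * t = r * x].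
Proof.
move=> maxM maxN MN x0.
have [hM hN] := (star_Max_prime maxM, star_Max_prime maxN).
apply: contrapT => nost; apply: MN.
have [|||P [hP Px PS]] := @exists_prime_disjoint R
    [set u | exists s t : R, [/\ ~ M s%:F, ~ N t%:F & u = s * t]] x x0.
- by exists 1, 1; rewrite mulr1; split=> //; apply: prime_notin1.
- move=> _ _ [s [t [Ms Nt ->]]] [s' [t' [Ms' Nt' ->]]].
  by exists (s * s'), (t * t'); rewrite mulrACA; split=> //; apply: prime_notinM.
- by move=> r [s [t [Ms Nt E]]]; apply: nost; exists s, t, r.
have PM : P `<=` M.
  move=> y Py; have [a _ aE] := prime_ideal_integral hP Py.
  rewrite -aE; rewrite -aE in Py; apply: contrapT => Ma; apply: (PS a) Py.
  by exists a, 1; rewrite mulr1; split=> //; apply: prime_notin1.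
have PN : P `<=` N.
  move=> y Py; have [a _ aE] := prime_ideal_integral hP Py.
  rewrite -aE; rewrite -aE in Py; apply: contrapT => Na; apply: (PS a) Py.
  by exists 1, a; rewrite mul1r; split=> //; apply: prime_notin1.
have [L [_ Luniq]] := hunique (sub_star_Max_star_prime maxM hP PM).
by rewrite -(Luniq M)// -(Luniq N).
Qed.

Lemma star_Max_isolated M (x : R) :
    star_local_star_invertibility star -> star_Max star M -> x != 0 ->
  exists2 s : R, ~ M s%:F &
    forall N, star_Max star N -> N x%:F -> N <> M -> N s%:F.
Proof.
move=> lsi maxM x0; have hM := star_Max_prime maxM.
(* The contraction of [x R_M] to [R]. *)
pose I := [set y | ring_set R y /\
  exists2 s : R, ~ M s%:F & exists r : R, s%:F * y = (r * x)%:F].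
have Ix : I x%:F.
  split; first exact: mem_ring_set.
  by exists 1; [exact: prime_notin1 | exists 1; rewrite rmorph1 !mul1r].
have hI : ideal I.
  apply: integral_idealI.
  - by exists x%:F; rewrite ?tofrac_eq0.
  - move=> y z [Ry [s Ms [r sE]]] [Rz [t Mt [q tE]]]; split; first exact: ring_setD.
    exists (s * t); first exact: prime_notinM.
    exists (t * r + s * q); rewrite mulrDl rmorphD -!mulrA 2!(rmorphM _ _ (_ * x)) /=.
    by rewrite -sE -tE rmorphM /=; ring.
  - move=> a y [Ry [s Ms [r sE]]]; split.
      by apply: ring_setM => //; apply: mem_ring_set.
    by exists s => //; exists (a * r); rewrite mulrCA sE -mulrA [RHS]rmorphM.
  - by move=> y [].
have sepI N : star_Max star N -> N <> M -> exists2 t : R, ~ N t%:F & I t%:F.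
  move=> maxN NM; have [|s [t [r [Ms Nt E]]]] := star_Max_separation maxM maxN _ x0.
    by move=> MN; apply: NM.
  exists t => //; split; first exact: mem_ring_set.
  by exists s => //; exists r; rewrite -rmorphM E.
have lpI N : star_Max star N -> locally_principal_at star N I.
  move=> maxN; apply/locally_principal_atP => //.
  have [->|NM] := pselect (N = M).
    exists x%:F; split=> //; first by rewrite tofrac_eq0.
    by move=> y [_ [s Ms [r E]]]; exists s => //; exists r; rewrite E rmorphM.
  have [t Nt It] := sepI N maxN NM.
  (* Away from [M], the ideal [I] contains a unit of the localization. *)
  exists t%:F; split=> //; first exact: (prime_notin_neq0 (star_Max_prime maxN)).
  by move=> y [[a _ <-] _]; exists t => //; exists a; rewrite mulrC.
have /(star_invertibleP hI)/(_ M maxM)[a [b [Ia /colonP bI Mab]]] := lsi I hI lpI.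
have [u _ uE] := bI a Ia.
have [_ [s Ms [r sE]]] := Ia.
(* Here [u = a b] and [s a = r x]. For [t] in [I] outside [N], [s u t = r x (b t)] lies in [xR],
   hence in [N], which forces [s u] into [N]. *)
exists (s * u).
  by apply: prime_notinM => //; rewrite uE mulrC.
move=> N maxN Nx NM; have hN := star_Max_prime maxN.
have [t Nt It] := sepI N maxN NM; have [v _ vE] := bI _ It.
have : N (s * u * t)%:F.
  have -> : (s * u * t)%:F = (v * r)%:F * x%:F.
    by rewrite !tofracM uE vE -[RHS]mulrA -[r%:F * _]tofracM -sE; ring.
  exact: (ideal_smul (prime_ideal_ideal hN)).
by move=> /(prime_ideal_mul hN)[].
Qed.

Hypothesis hfinite : finite_type star.

Lemma local_invertibility_finite_character :
  star_local_star_invertibility star -> star_finite_character star.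
Proof.
move=> lsi x x0.
pose Y := [set M | star_Max star M /\ M x%:F].
pose J := [set y | ring_set R y /\ finite_set [set M | Y M /\ ~ M y]].
have Jx : J x%:F.
  split; first exact: mem_ring_set.
  by apply: sub_finite_set (finite_set0 _) => M [[]].
have JR : integral J by move=> y [].
have hJ : ideal J.
  apply: integral_idealI => //.
  - by exists x%:F; rewrite ?tofrac_eq0.
  - move=> y z [Ry fy] [Rz fz]; split; first exact: ring_setD.
    apply: (@sub_finite_set _ _
      ([set M | Y M /\ ~ M y] `|` [set M | Y M /\ ~ M z])); last first.
      by rewrite finite_setU.
    move=> M [YM Myz]; apply: contrapT => /not_orP[nMy nMz]; apply: Myz.
    apply: (ideal_add (prime_ideal_ideal (star_Max_prime YM.1))).
    + by apply: contrapT => My; apply: nMy.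
    + by apply: contrapT => Mz; apply: nMz.
  - move=> a y [Ry fy]; split; first by apply: ring_setM => //; apply: mem_ring_set.
    apply: sub_finite_set fy => M [YM May]; split=> // My; apply: May.
    exact: (ideal_smul (prime_ideal_ideal (star_Max_prime YM.1))).
have : star J 1.
  apply/(starP _ hJ) => M maxM.
  have [Mx|Mx] := pselect (M x%:F); last by exists x; rewrite ?mulr1.
  have [s Ms sY] := star_Max_isolated lsi maxM x0.
  (* The isolating element can fail to lie only in the member [M] of [Y]. *)
  exists s; rewrite ?mulr1//; split; first exact: mem_ring_set.
  apply: sub_finite_set (finite_set1 M) => N [[maxN Nx] Ns].
  by apply: contrapT => NM; apply: Ns; apply: sY.
rewrite hfinite// => -[J0 [hJ0 [n [g J0E]] J0J] /(starP _ hJ0) J01].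
have Jg i : J (g i).
  apply: J0J; rewrite J0E; exists (fun j => (j == i)%:R).
  rewrite (bigD1 i)//= eqxx rmorph1 mul1r big1 ?addr0// => j /negPf ->.
  by rewrite rmorph0 mul0r.
(* No star-maximal ideal contains all the generators [g i], so finitely many finite sets cover
   [Y]. *)
apply: (@sub_finite_set _ _ (\bigcup_(i in [set: 'I_n]) [set M | Y M /\ ~ M (g i)])).
  move=> M YM; have hM := star_Max_prime YM.1; apply: contrapT => noi.
  have [s Ms] := J01 M YM.1; rewrite mulr1 J0E => -[c sE]; apply: Ms; rewrite sE.
  apply: (ideal_sum (prime_ideal_ideal hM)) => i.
  apply: (ideal_smul (prime_ideal_ideal hM)); apply: contrapT => Mg.
  by apply: noi; exists i.
by apply: bigcup_finite => [|i _]; [exact: finite_finset | have [] := Jg i].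
Qed.

End Star.

Theorem proposition5p5 (R : idomainType)
    (star : set {fraction R} -> set {fraction R})
    (hstar : star_operation star)
    (htilde : forall I, ideal I -> star I = star_tilde star I)
    (hspectral : spectral star)
    (hfinite : finite_type star)
    (hunique : forall P, star_prime star P ->
       exists! M, star_Max star M /\ P `<=` M) :
  star_finite_character star <-> star_local_star_invertibility star.
Proof.
split; first exact: finite_character_local_invertibility.
exact: local_invertibility_finite_character.
Qed.
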